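(* Let $\mathcal{X}\subseteq\mathbb{R}^d$, $\mathcal{Y}=[K]$, consider an $\ell_p$ norm with $p\in(1,\infty]$, and let $\epsilon>0$. For any $\mu\in\mathcal{P}(\mathcal{X}\times\mathcal{Y})$ with support $s_\mu$ and probability vector $\boldsymbol{\omega}_\mu$, $$\mathrm{rg}(\mu,\epsilon)=\mathrm{FP}(H_{s_\mu}^\epsilon,\boldsymbol{\omega}_\mu)-\mathrm{IP}(H_{s_\mu}^\epsilon,\boldsymbol{\omega}_\mu).$$
   Context: Notation: $[K]=\{1,\dots,K\}$; $\Delta^n=\{u\in\mathbb{R}_+^n:\sum_i u^{(i)}=1\}$; $B_p(x,\epsilon)=\{x'\in\mathcal{X}:\|x'-x\|_p\le\epsilon\}$. $\mathcal{P}(\mathcal{Z})$ is the set of probability distributions with finite support on $\mathcal{Z}$; a distribution $\mu\in\mathcal{P}(\mathcal{Z})$ is described by its support $s_\mu=(z_1,\dots,z_n)$ (distinct points) and its probability vector $\boldsymbol{\omega}_\mu\in\Delta^n$, assigning mass $\boldsymbol{\omega}_\mu^{(i)}$ to $z_i$. Risks and randomization gap: $\mathcal{F}_{\mathrm{det}}$ is the set of all functions $f:\mathcal{X}\to\mathcal{Y}$ and $\mathcal{F}_{\mathrm{rand}}$ the set of all functions $f:\mathcal{X}\to\mathcal{P}(\mathcal{Y})$. For $\mu\in\mathcal{P}(\mathcal{X}\times\mathcal{Y})$, $$\mathcal{R}^*_{\mathcal{F}_{\mathrm{det}}}(\mu,\epsilon)=\inf_{f\in\mathcal{F}_{\mathrm{det}}}\mathbb{E}_{(x,y)\sim\mu}\Big[\sup_{x'\in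 B_p(x,\epsilon)}\mathbf{1}\{f(x')\neq y\}\Big],$$ $$\mathcal{R}^*_{\mathcal{F}_{\mathrm{rand}}}(\mu,\epsilon)=\inf_{f\in\mathcal{F}_{\mathrm{rand}}}\mathbb{E}_{(x,y)\sim\mu}\Big[\sup_{x'\in B_p(x,\epsilon)}\mathbb{E}_{z\sim f(x')}[\mathbf{1}\{z\neq y\}]\Big],$$ and $\mathrm{rg}(\mu,\epsilon)=\mathcal{R}^*_{\mathcal{F}_{\mathrm{det}}}(\mu,\epsilon)-\mathcal{R}^*_{\mathcal{F}_{\mathrm{rand}}}(\mu,\epsilon)$. Conflict hypergraph: for $s_\mu=\{(x_i,y_i)\}_{i\in[n]}$, the conflict hypergraph $H_{s_\mu}^\epsilon$ has vertex set $[n]$, and a nonempty $e\subseteq[n]$ is a hyperedge iff (1) $y_i\neq y_j$ for all distinct $i,j\in e$, and (2) $\bigcap_{i\in e}B_p(x_i,\epsilon)\neq\emptyset$. (Fractional) set packing: for a hypergraph $H=([n],\mathcal{E})$ and $\boldsymbol{\omega}\in\mathbb{R}_+^n$, let $\mathcal{Q}(H)=\{q\in\{0,1\}^n:\sum_{i\in e}q^{(i)}\le1\ \forall e\in\mathcal{E}\}$, $\mathcal{Q}^{\mathrm{frac}}(H)=\{q\in[0,1]^n:\sum_{i\in e}q^{(i)}\le1\ \forall e\in\mathcal{E}\}$, $\mathrm{IP}(H,\boldsymbol{\omega})=\max_{q\in\mathcal{Q}(H)}\boldsymbol{\omega}^Tq$ and $\mathrm{FP}(H,\boldsymbol{\omega})=\max_{q\in\mathcal{Q}^{\mathrm{frac}}(H)}\boldsymbol{\omega}^Tq$.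 *)

(* Defs.v *)
(* MathComp-Analysis; the real line is an arbitrary [R : realType]. *)
From HB Require Import structures.
From mathcomp Require Import all_boot all_order all_algebra.
From mathcomp Require Import all_classical all_reals all_analysis.
Set Implicit Arguments.
Unset Strict Implicit.
Unset Printing Implicit Defensive.
Import Order.TTheory GRing.Theory Num.Theory.
Import numFieldTopology.Exports numFieldNormedType.Exports.
Local Open Scope classical_set_scope.
Local Open Scope ring_scope.

Definition simplex (R : realType) (n : nat) : set 'rV[R]_n :=
  [set u | (forall i, 0 <= u ord0 i) /\ \sum_(i < n) u ord0 i = 1].

(* A finitely supported distribution is given by distinct points together with
   a vector of the simplex; zero weights are allowed, as they are there. *)
Record fdist (R : realType) (Z : Type) := FDist {
  fd_size : nat;
  fd_supp : 'I_fd_size -> Z;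
  fd_prob : 'rV[R]_fd_size;
  fd_supp_inj : injective fd_supp;
  fd_prob_simplex : simplex fd_prob }.
Arguments fd_supp {R Z} f i.
Arguments fd_prob {R Z} f.

Definition expect (R : realType) (Z : Type) (mu : fdist R Z) (g : Z -> R) : R :=
  \sum_(i < fd_size mu) fd_prob mu ord0 i * g (fd_supp mu i).

(* For p = +oo this uses the library norm on row vectors, which is the maximum
   of the absolute values of the entries. The value at p = -oo is irrelevant. *)
Definition lp_norm (R : realType) (d : nat) (p : \bar R) (u : 'rV[R]_d) : R :=
  match p with
  | r%:E => (\sum_(i < d) `|u ord0 i| `^ r) `^ r^-1
  | +oo%E => `|u|
  | -oo%E => 0
  end.

(* The points of the ball are points of X, not of the ambient space. *)
Definition lp_ball (R : realType) (d : nat) (X : set 'rV[R]_d) (p : \bar R)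
    (x : X) (eps : R) : set X :=
  [set x' : X | lp_norm p (val x' - val x) <= eps].

Section Risks.
Variables (R : realType) (d K : nat) (X : set 'rV[R]_d) (p : \bar R).
Implicit Types (mu : fdist R (X * 'I_K)) (eps : R).

Definition det_risk mu eps (f : X -> 'I_K) : R :=
  expect mu (fun z => sup [set (f x' != z.2)%:R | x' in lp_ball p z.1 eps]).

Definition rand_risk mu eps (f : X -> fdist R 'I_K) : R :=
  expect mu (fun z => sup [set expect (f x') (fun y => (y != z.2)%:R)
                          | x' in lp_ball p z.1 eps]).

Definition opt_det_risk mu eps : R := inf (range (det_risk mu eps)).
Definition opt_rand_risk mu eps : R := inf (range (rand_risk mu eps)).

Definition rand_gap mu eps : R := opt_det_risk mu eps - opt_rand_risk mu eps.

End Risks.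

(* A hypergraph on the vertex set 'I_n is identified with its set of edges. *)
Definition hypergraph (n : nat) := set {set 'I_n}.

Definition conflict_hypergraph (R : realType) (d K : nat) (X : set 'rV[R]_d)
    (p : \bar R) (n : nat) (s : 'I_n -> X * 'I_K) (eps : R) : hypergraph n :=
  [set e | [/\ e != finset.set0,
      {in e &, forall i j, i != j -> (s i).2 != (s j).2} &
      \bigcap_(i in [set` e]) lp_ball p (s i).1 eps !=set0]].

Section Packing.
Variables (R : realType) (n : nat).
Implicit Types (H : hypergraph n) (w q : 'rV[R]_n).

Definition packing H : set 'rV[R]_n :=
  [set q | (forall i, q ord0 i = 0 \/ q ord0 i = 1) /\
           (forall e, H e -> \sum_(i in e) q ord0 i <= 1)].

Definition frac_packing H : set 'rV[R]_n :=
  [set q | (forall i, 0 <= q ord0 i <= 1) /\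
           (forall e, H e -> \sum_(i in e) q ord0 i <= 1)].

Definition dotr w q : R := \sum_(i < n) w ord0 i * q ord0 i.

(* These suprema are maxima: see [IP_max] and [FP_max]. *)
Definition IP H w : R := sup [set dotr w q | q in packing H].
Definition FP H w : R := sup [set dotr w q | q in frac_packing H].

Lemma sum_coord_continuous (P : pred 'I_n) w :
  continuous (fun q : 'rV[R]_n => \sum_(i < n | P i) w ord0 i * q ord0 i).
Proof.
apply: (continuous_big (op := +%R)); first exact: (@add_continuous R^o).
move=> i _ q; apply: (@continuous_comp _ _ _ (fun q : 'rV[R]_n => q ord0 i)).
  exact: coord_continuous.
exact: mulrl_continuous.
Qed.

Lemma sup_dotr_max (A : set R) H w : A 0 -> compact A ->
  let Q := [set q : 'rV[R]_n | (forall i, A (q ord0 i)) /\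
              (forall e, H e -> \sum_(i in e) q ord0 i <= 1)] in
  exists2 q, Q q & sup [set dotr w q | q in Q] = dotr w q.
Proof.
move=> A0 cA Q.
have cQ : compact Q.
  have -> : Q = [set q : 'rV[R]_n | forall i, A (q ord0 i)] `&`
      \bigcap_(e in H)
        (fun q : 'rV[R]_n => \sum_(i in e) q ord0 i) @^-1` [set x | x <= 1].
    by [].
  apply: compact_closedI; first by apply: (rV_compact (A := fun=> A)).
  apply: closed_bigI => e _; apply: preimage_closed; last exact: closed_le.
  move=> q _; have := @sum_coord_continuous (mem e) (const_mx 1) q.
  by under eq_fun do under eq_bigr do rewrite mxE mul1r.
have Q0 : Q 0.
  split=> [i|e _]; first by rewrite mxE.
  by rewrite big1 ?ler01 // => i _; rewrite mxE.
have [|c /set_mem Qc cmax] := EVT_max_rV (f := dotr w) (ex_intro _ _ Q0) cQ.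
  by apply: continuous_subspaceT; exact: sum_coord_continuous.
have ub : ubound [set dotr w q | q in Q] (dotr w c).
  by move=> _ [q Qq <-]; apply: cmax; exact: mem_set.
exists c => //; apply/eqP; rewrite eq_le; apply/andP; split.
  by apply: ge_sup => //; exists (dotr w c), c.
by apply: ub_le_sup; [exists (dotr w c)|exists c].
Qed.

Lemma IP_max H w : exists2 q, packing H q & IP H w = dotr w q.
Proof.
apply: (@sup_dotr_max [set x | x = 0 \/ x = 1]); first by left.
by apply: compactU; exact: compact_set1.
Qed.

Lemma FP_max H w : exists2 q, frac_packing H q & FP H w = dotr w q.
Proof.
apply: (@sup_dotr_max [set x | 0 <= x <= 1]) => /=; first by rewrite lexx ler01.
rewrite (_ : [set _ | _] = `[0, 1]%classic); first exact: segment_compact.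
by apply/seteqP; split=> x /=; rewrite in_itv.
Qed.

End Packing.

(* Main.v *)
(* A classifier with losses [loss x y] certifies at the support point (x_i, y_i)
   the accuracy q_i = inf (1 - loss x' y_i) over the ball around x_i, and its
   adversarial risk is 1 - w.q. The accuracies at a common point of the balls of
   a conflict edge sum to at most 1, as the labels are distinct, so q is a
   fractional packing, and an integral one if the classifier is deterministic.
   Conversely a fractional packing q is certified by predicting at x' each label
   k with probability the largest q_i among the i with y_i = k whose ball
   contains x': the maximisers form a conflict edge, so the total is at most 1.
   Hence the optimal risks are 1 - FP and 1 - IP. *)
Require Import Defs.
From mathcomp Require Import all_boot all_order all_algebra.
From mathcomp Require Import all_classical all_reals all_analysis.
Set Implicit Arguments.
Unset Strict Implicit.
Unset Printing Implicit Defensive.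
Import Order.TTheory GRing.Theory Num.Theory.
Import numFieldTopology.Exports numFieldNormedType.Exports.
Local Open Scope classical_set_scope.
Local Open Scope ring_scope.

Lemma inf_min (R : realType) (A : set R) m : A m -> lbound A m -> inf A = m.
Proof.
move=> Am lbm; apply/eqP; rewrite eq_le; apply/andP; split.
  by apply: ge_inf => //; exists m.
by apply: lb_le_inf => //; exists m.
Qed.

(** Keeps the sets of losses over a ball nonempty; the supremum of an empty set would default to
    0. *)
Lemma lp_ball_center (R : realType) (d : nat) (X : set 'rV[R]_d) (p : \bar R)
    (hp : (1 < p)%E) (x : X) (eps : R) :
  0 < eps -> lp_ball p x eps x.
Proof.
move=> heps; rewrite /lp_ball /= subrr.
case: p hp => [r||] //=; last by rewrite normr0 => _; exact: ltW.
(* The exponent has to be nonzero, since 0 to the power 0 is 1. *)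
rewrite lte_fin => r1; have r0 : r != 0 by rewrite gt_eqF// (lt_trans ltr01).
rewrite big1 => [|i _]; last by rewrite mxE normr0 powR0.
by rewrite powR0 ?invr_eq0// ltW.
Qed.

(** * Expectations of indicators and completion of subprobabilities *)

Section FiniteDistributions.
Variables (R : realType).

Lemma fd_prob_ge0 (Z : Type) (mu : fdist R Z) i : 0 <= fd_prob mu ord0 i.
Proof. by case: (fd_prob_simplex mu). Qed.

Lemma fd_prob_sum (Z : Type) (mu : fdist R Z) : \sum_i fd_prob mu ord0 i = 1.
Proof. by case: (fd_prob_simplex mu). Qed.

Lemma expect_ge0 (Z : Type) (mu : fdist R Z) g :
  (forall z, 0 <= g z) -> 0 <= expect mu g.
Proof. by move=> g0; apply: sumr_ge0 => i _; rewrite mulr_ge0 ?fd_prob_ge0. Qed.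

Lemma expectC (Z : Type) (mu : fdist R Z) g :
  expect mu (fun z => 1 - g z) = 1 - expect mu g.
Proof.
rewrite /expect -[X in _ = X - _](fd_prob_sum mu) -sumrB.
by apply: eq_bigr => i _; rewrite mulrBr mulr1.
Qed.

Lemma expect_neq (Z : eqType) (mu : fdist R Z) y :
  expect mu (fun z => (z != y)%:R) = 1 - expect mu (fun z => (z == y)%:R).
Proof.
rewrite -expectC; congr expect; apply/funext => z.
by case: eqP; rewrite ?subrr ?subr0.
Qed.

Lemma expect_eq_sum (Z : finType) (mu : fdist R Z) :
  \sum_y expect mu (fun z => (z == y)%:R) = 1.
Proof.
rewrite /expect exchange_big /= -[RHS](fd_prob_sum mu); apply: eq_bigr => i _.
rewrite -mulr_sumr (bigD1 (fd_supp mu i))//= eqxx big1 ?addr0 ?mulr1// => y.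
by rewrite eq_sym => /negbTE ->.
Qed.

(** The missing mass is put on the default label [k0], which can only increase the other bounds'
    slack; all of ['I_K] serves as support. *)
Lemma subprobability_fdist (K : nat) (k0 : 'I_K) (a : 'I_K -> R) :
  (forall k, 0 <= a k) -> \sum_k a k <= 1 ->
  exists nu : fdist R 'I_K,
    forall k, a k <= expect nu (fun z => (z == k)%:R).
Proof.
move=> a0 a1.
pose w : 'rV[R]_K :=
  \row_k (a k + (if k == k0 then 1 - \sum_j a j else 0)).
have aw k : a k <= w ord0 k.
  by rewrite mxE lerDl; case: ifP; rewrite // subr_ge0.
have ws : simplex w.
  split=> [k|]; first exact: le_trans (aw k).
  under eq_bigr do rewrite mxE.
  by rewrite big_split /= -big_mkcond /= big_pred1_eq addrC subrK.
exists (FDist (@inj_id 'I_K) ws) => k.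
rewrite /expect /= (bigD1 k)//= eqxx mulr1 big1 ?addr0// => i /negbTE ->.
by rewrite mulr0.
Qed.

End FiniteDistributions.

Section Packings.
Variables (R : realType) (n : nat) (H : hypergraph n).

Lemma sub_packing_frac : packing H `<=` @frac_packing R n H.
Proof.
move=> q [q01 qH]; split=> // i.
by case: (q01 i) => ->; rewrite lexx ler01.
Qed.

(** Coordinates of [q] are at most 1, so the total weight bounds the objective and [sup] is an
    actual upper bound. Stated for a subset [Q] to cover both [FP] and [IP]. *)
Lemma dotr_le_sup (Q : set 'rV[R]_n) (w q : 'rV[R]_n) :
  (forall i, 0 <= w ord0 i) -> Q `<=` frac_packing H -> Q q ->
  dotr w q <= sup [set dotr w q | q in Q].
Proof.
move=> w0 QH Qq; apply: ub_le_sup; last by exists q.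
exists (\sum_i w ord0 i) => _ [r /QH[r01 _] <-].
apply: ler_sum => i _; rewrite ler_piMr//.
by case/andP: (r01 i).
Qed.

End Packings.

(** * Adversarial risk as an affine function of the certified accuracies *)

Section AdversarialRisk.
Variables (R : realType) (d K : nat) (X : set 'rV[R]_d) (p : \bar R) (eps : R).
Variables (hp : (1 < p)%E) (heps : 0 < eps) (mu : fdist R (X * 'I_K)).

Local Notation n := (fd_size mu).
Local Notation pt i := (fd_supp mu i).1.
Local Notation label i := (fd_supp mu i).2.
Local Notation ball i := (lp_ball p (pt i) eps).
Local Notation H := (conflict_hypergraph p (fd_supp mu) eps).
Local Notation w := (fd_prob mu).

(** Treats both risks at once: [loss] is the 0-1 loss of a deterministic classifier or the expected
    0-1 loss of a randomized one. *)
Definition adv_loss (loss : X -> 'I_K -> R) (z : X * 'I_K) : R :=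
  sup [set loss x z.2 | x in lp_ball p z.1 eps].

Definition certified_accuracy (loss : X -> 'I_K -> R) : 'rV[R]_n :=
  \row_i (1 - adv_loss loss (fd_supp mu i)).

Lemma adv_risk_accuracy loss :
  expect mu (adv_loss loss) = 1 - dotr w (certified_accuracy loss).
Proof.
rewrite /dotr -[X in _ = X - _](fd_prob_sum mu) -sumrB; apply: eq_bigr => i _.
by rewrite mxE mulrBr mulr1 opprB addrCA subrr addr0.
Qed.

Lemma adv_loss_le loss z c :
  (forall x, lp_ball p z.1 eps x -> loss x z.2 <= c) -> adv_loss loss z <= c.
Proof.
move=> lossc; apply: ge_sup => [|_ [x xB <-]]; last exact: lossc.
by exists (loss z.1 z.2), z.1 => //; exact: lp_ball_center.
Qed.

Lemma adv_risk_le loss (q : 'rV[R]_n) :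
  (forall i x, ball i x -> loss x (label i) <= 1 - q ord0 i) ->
  expect mu (adv_loss loss) <= 1 - dotr w q.
Proof.
move=> lossq; rewrite adv_risk_accuracy lerD2l lerN2.
apply: ler_sum => i _; rewrite ler_wpM2l ?fd_prob_ge0// mxE lerBrDr -lerBrDl.
by apply: adv_loss_le; exact: lossq.
Qed.

Section Accuracy.
Variable loss : X -> 'I_K -> R.
Hypothesis loss01 : forall x y, 0 <= loss x y <= 1.

Lemma le_adv_loss z x : lp_ball p z.1 eps x -> loss x z.2 <= adv_loss loss z.
Proof.
move=> xB; apply: ub_le_sup; last by exists x.
by exists 1 => _ [x' _ <-]; case/andP: (loss01 x' z.2).
Qed.

Lemma certified_accuracy_frac_packing :
  (forall x, \sum_y (1 - loss x y) <= 1) ->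
  frac_packing H (certified_accuracy loss).
Proof.
move=> loss_sum; split=> [i|e [_ e_inj [x xe]]].
  rewrite mxE subr_ge0 gerBl adv_loss_le /= => [|x _]; last first.
    by case/andP: (loss01 x (label i)).
  apply: le_trans (@le_adv_loss (fd_supp mu i) (pt i) _).
    by case/andP: (loss01 (pt i) (label i)).
  exact: lp_ball_center.
(* At the common point [x], the sum over [e] is reindexed by labels, injectively on [e], and then
   extended to all labels by nonnegative terms. *)
apply: le_trans (loss_sum x).
have inj_label : {in e &, injective (fun i => label i)}.
  move=> i j ie je /eqP; apply: contraTeq => ij; exact: e_inj.
apply: (@le_trans _ _ (\sum_(i in e) (1 - loss x (label i)))).
  apply: ler_sum => i ie; rewrite mxE lerD2l lerN2.
  by apply: le_adv_loss; exact: xe.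
rewrite -(big_imset (fun y => 1 - loss x y) inj_label) /=.
rewrite [leLHS]big_mkcond /=; apply: ler_sum => y _.
by case: ifP => // _; rewrite subr_ge0; case/andP: (loss01 x y).
Qed.

(** A loss with values 0 and 1 either reaches 1 on the ball, giving accuracy 0, or vanishes on it,
    giving accuracy 1. *)
Lemma certified_accuracy_packing :
  (forall x, \sum_y (1 - loss x y) <= 1) ->
  (forall x y, loss x y = 0 \/ loss x y = 1) ->
  packing H (certified_accuracy loss).
Proof.
move=> loss_sum lossb.
have [acc01 accH] := certified_accuracy_frac_packing loss_sum.
split=> // i; have /andP[acc0 acc1] := acc01 i.
have [[x xB x1]|no1] := pselect (exists2 x, ball i x & loss x (label i) = 1).
  left; apply/eqP; rewrite eq_le acc0 andbT mxE subr_le0 -x1.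
  exact: le_adv_loss.
right; apply/eqP; rewrite eq_le acc1 mxE lerBrDl gerDr.
apply: adv_loss_le => x xB.
by case: (lossb x (label i)) => [->//|x1]; case: no1; exists x.
Qed.

End Accuracy.

(** * From packings to classifiers *)

Lemma frac_packing_subprobability (q : 'rV[R]_n) : frac_packing H q ->
  forall x : X, exists a : 'I_K -> R,
    [/\ forall k, 0 <= a k, \sum_k a k <= 1 &
        forall i, ball i x -> q ord0 i <= a (label i)].
Proof.
move=> [q01 qH] x.
pose P k : pred 'I_n := fun i => (label i == k) && `[< ball i x >].
(* [c k] selects a maximiser of [q] among the vertices of label [k] whose ball contains [x], or
   [None] if there is no such vertex. *)
have /choice[c cP] : forall k, exists o : option 'I_n,
    if o is Some i then P k i /\ forall j, P k j -> q ord0 j <= q ord0 i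
    else forall j, ~~ P k j.
  move=> k; have [/existsP[i0 Pi0]|/existsPn noP] := boolP [exists i, P k i].
    case: (arg_maxP (fun i => q ord0 i) Pi0) => i Pi imax.
    by exists (Some i); split.
  by exists None.
have cK k i : c k = Some i -> label i = k /\ ball i x.
  by move=> ck; move: (cP k); rewrite ck => -[/andP[/eqP ? /asboolP ?] _].
(* The selected vertices, each being the choice for its own label; hence their labels are distinct
   and [x] lies in all their balls. The empty set is not an edge and is treated apart. *)
pose e := [set i | c (label i) == Some i]%SET.
exists (fun k => oapp (fun i => q ord0 i) 0 (c k)); split.
- by move=> k; case: (c k) => //= i; case/andP: (q01 i).
- suff -> : \sum_k oapp (fun i => q ord0 i) 0 (c k) = \sum_(i in e) q ord0 i.
    have [->|e0] := eqVneq e finset.set0; first by rewrite big_set0 ler01.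
    apply: qH; split=> //.
      move=> i j; rewrite !inE => /eqP ci /eqP cj; apply: contra => /eqP ij.
      by move: ci; rewrite ij cj => -[->].
    by exists x => i /=; rewrite inE => /eqP /cK[].
  (* Each label selects at most one vertex, and a vertex can only be selected by its own label, so
     exchanging the sums leaves the sum over [e]. *)
  transitivity (\sum_k \sum_(i | c k == Some i) q ord0 i).
    apply: eq_bigr => k _; case: (c k) => [i|] /=; last by rewrite big_pred0.
    by rewrite (big_pred1 i)// => j; rewrite /= eq_sym.
  rewrite (exchange_big_dep predT)//= [RHS]big_mkcond /=.
  apply: eq_bigr => i _; rewrite inE; case: ifPn => [/eqP ci|ci].
    rewrite (big_pred1 (label i))// => k /=; apply/eqP/eqP => [/cK[]//|->].
    exact: ci.
  rewrite big_pred0// => k; apply: contraNF ci => /eqP ck.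
  by have [-> _] := cK _ _ ck; rewrite ck.
- move=> i xB; have Pi : P (label i) i by rewrite /P eqxx; apply/asboolP.
  by move: (cP (label i)); case: (c _) => [j [_]|/(_ i)]; [apply|rewrite Pi].
Qed.

(** Weights summing to 1 force a nonempty support, whose first point carries a label. It is the
    default prediction and receives leftover mass. *)
Lemma label_inhabited : 'I_K.
Proof.
suff i0 : 'I_n by exact: (label i0).
case: (mu) => -[|m] s v _ [_] /=; last by move=> _; exact: ord0.
by rewrite big_ord0 => /eqP; rewrite eq_sym oner_eq0.
Qed.

Lemma opt_rand_riskE : opt_rand_risk p mu eps = 1 - FP H w.
Proof.
pose loss (f : X -> fdist R 'I_K) x y := expect (f x) (fun z => (z != y)%:R).
have riskE f : rand_risk p mu eps f = expect mu (adv_loss (loss f)) by [].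
have lb : lbound (range (rand_risk p mu eps)) (1 - FP H w).
  move=> _ [f _ <-]; rewrite riskE adv_risk_accuracy lerD2l lerN2.
  apply: (@dotr_le_sup _ _ H) => //; first exact: fd_prob_ge0.
  apply: certified_accuracy_frac_packing => [x y|x].
    by rewrite {2}/loss expect_neq gerBl !expect_ge0//.
  (* The accuracies at [x] are the probabilities of the labels under [f x]. *)
  by under eq_bigr do rewrite /loss expect_neq subKr; rewrite expect_eq_sum.
apply: inf_min => //.
have [q Qq FPq] := FP_max H w.
have /choice[f fq] : forall x : X, exists nu : fdist R 'I_K, forall i,
    ball i x -> q ord0 i <= expect nu (fun z => (z == label i)%:R).
  move=> x; have [a [a0 a1 qa]] := frac_packing_subprobability Qq x.
  have [nu nua] := subprobability_fdist label_inhabited a0 a1.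
  by exists nu => i /qa /le_trans; apply.
exists f => //; apply/eqP; rewrite eq_le lb ?andbT; last by exists f.
rewrite FPq riskE; apply: adv_risk_le => i x xB.
by rewrite /loss expect_neq lerD2l lerN2; exact: fq.
Qed.

Lemma opt_det_riskE : opt_det_risk p mu eps = 1 - IP H w.
Proof.
pose loss (f : X -> 'I_K) x y : R := (f x != y)%:R.
have riskE f : det_risk p mu eps f = expect mu (adv_loss (loss f)) by [].
have lb : lbound (range (det_risk p mu eps)) (1 - IP H w).
  move=> _ [f _ <-]; rewrite riskE adv_risk_accuracy lerD2l lerN2.
  apply: (@dotr_le_sup _ _ H); [exact: fd_prob_ge0|exact: sub_packing_frac|].
  apply: certified_accuracy_packing => [x y|x|x y].
  - by rewrite /loss; case: eqP; rewrite lexx ler01.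
  - rewrite (bigD1 (f x))//= /loss eqxx subr0 big1 ?addr0// => y.
    by rewrite eq_sym => ->; rewrite subrr.
  - by rewrite /loss; case: eqP; [left|right].
apply: inf_min => //.
have [q [q01 qH] IPq] := IP_max H w.
pose good x : pred 'I_n := fun i => (q ord0 i == 1) && `[< ball i x >].
pose f x := if [pick i | good x i] is Some i then label i else label_inhabited.
exists f => //; apply/eqP; rewrite eq_le lb ?andbT; last by exists f.
rewrite IPq riskE; apply: adv_risk_le => i x xB.
case: (q01 i) => qi; rewrite qi ?subr0 ?subrr /loss.
  by case: eqP; rewrite ?ler01.
suff -> : f x = label i by rewrite eqxx.
rewrite /f; case: pickP => [j /andP[/eqP qj /asboolP xBj]|/(_ i)]; last first.
  by rewrite /good qi eqxx; move/asboolP.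
(* Two such vertices with different labels would form a conflict edge of total 2, against the
   packing constraint. *)
apply/eqP; apply: contraT => ji.
have jni : j != i by apply: contra ji => /eqP ->.
have : H [set j; i]%SET.
  split; first by apply/set0Pn; exists j; rewrite !inE eqxx.
    move=> a b; rewrite !inE => /orP[]/eqP-> /orP[]/eqP->; rewrite ?eqxx//.
    by rewrite [label i == _]eq_sym.
  by exists x => a /=; rewrite !inE => /orP[]/eqP->.
by move/qH; rewrite big_setU1 ?inE//= big_set1 qi qj gerDl ler10.
Qed.

End AdversarialRisk.

Theorem corollary3p1 (R : realType) (d K : nat) (X : set 'rV[R]_d)
    (p : \bar R) (hp : (1 < p)%E) (eps : R) (heps : 0 < eps)
    (mu : fdist R (X * 'I_K)) :
  rand_gap p mu eps =
    FP (conflict_hypergraph p (fd_supp mu) eps) (fd_prob mu)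
    - IP (conflict_hypergraph p (fd_supp mu) eps) (fd_prob mu).
Proof.
rewrite /rand_gap opt_det_riskE// opt_rand_riskE//.
by rewrite opprB addrC addrA subrK.
Qed.
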